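(* Let $p\colon\mathbb{E}\to\mathbb{B}$ be a locally small fibration where $\mathbb{B}$ has finite limits, and let $m$ and $f$ be vertical morphisms of $\mathbb{E}$. Then the following are equivalent. (1) Every family of lifting problems from $m$ to $f$ has a solution. (2) The universal family of lifting problems from $m$ to $f$ has a solution. (3) There is a coherent choice of solutions to all families of lifting problems from $m$ to $f$.
   Context: $p$ is a cloven Grothendieck fibration with reindexing $\sigma^*$. A map is vertical over $I$ if $p$ sends it to $1_I$; $\mathbb{E}_I$ is the fibre category. $V(\mathbb{E})$ is the full subcategory of $\mathbb{E}^{\mathbf 2}$ on vertical maps, fibred over $\mathbb{B}$ by $p\circ\mathrm{dom}=p\circ\mathrm{cod}$ with levelwise reindexing. $p$ is locally small if for all $I$ and $X,Y\in\mathbb{E}_I$ the functor $(\mathbb{B}/I)^{op}\to\mathbf{Set}$, $(u\colon J\to I)\mapsto\mathbb{E}_J(u^*X,u^*Y)$, is representable. Let $m\colon U\to V$ be vertical over $I$ and $f\colon X\to Y$ vertical over $J$. A family of lifting problems from $m$ to $f$ over $K$ consists of $K\in\mathbb{B}$, maps $\sigma\colon K\to I$, $\tau\colon K\to J$, and a commutative square in $\mathbb{E}_K$ with left side $\sigma^*(m)$ and right side $\tau^*(f)$; equivalently a morphism $h\colon\sigma^*(m)\to f$ of $V(\mathbb{E})$ over $\tau$. A solution is a map $j\colon\sigma^*(V)\to\tau^*(X)$ in $\mathbb{E}_K$ making both triangles commute (equivalently $j\colon\sigma^*(V)\to X$ over $\tau$ with both triangles commuting). Any $k\colon K'\to K$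 takes a family over $K$ to one over $K'$ with $\sigma'=\sigma k$, $\tau'=\tau k$, by applying $k^*$ (equivalently, composing $h$ with the canonical cartesian map $(\sigma k)^*(m)\to\sigma^*(m)$ over $k$). A coherent choice of solutions is a choice of a solution for each family of lifting problems from $m$ to $f$ such that, for each such $k$ and each family over $K$, the solution chosen for the induced family over $K'$ is $k^*$ of the solution chosen for the family over $K$. The universal family of lifting problems from $m$ to $f$ is given by the hom object $\underline{\mathrm{Hom}}(m,f)$ in $V(\mathbb{E})\to\mathbb{B}$: a family $(\underline{\mathrm{Hom}}(m,f),\sigma,\tau,h)$ such that every family of lifting problems over any $K'$ is obtained from it by applying $t^*$ for a unique $t\colon K'\to\underline{\mathrm{Hom}}(m,f)$. *)

(* Defs.v *)
From Stdlib Require Import List FinFun Classical ClassicalEpsilon FunctionalExtensionality.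

Set Implicit Arguments.
Unset Strict Implicit.
Unset Printing Implicit Defensive.

Declare Scope cat_scope.
Delimit Scope cat_scope with cat.
Local Open Scope cat_scope.

Record Category := MkCategory {
  Ob :> Type;
  Hom : Ob -> Ob -> Type;
  idm : forall X, Hom X X;
  comp : forall X Y Z, Hom Y Z -> Hom X Y -> Hom X Z;
  comp_id_l : forall X Y (f : Hom X Y), comp (idm Y) f = f;
  comp_id_r : forall X Y (f : Hom X Y), comp f (idm X) = f;
  comp_assoc : forall W X Y Z (h : Hom Y Z) (g : Hom X Y) (f : Hom W X),
    comp h (comp g f) = comp (comp h g) f
}.
Arguments Hom {c} X Y.
Arguments idm {c} X.
Arguments comp {c X Y Z} g f : rename.
Notation "g ∘ f" := (comp g f) (at level 40, left associativity) : cat_scope.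

Record Functor (C D : Category) := MkFunctor {
  fobj :> C -> D;
  fmap : forall X Y : C, Hom X Y -> Hom (fobj X) (fobj Y);
  fmap_id : forall X : C, fmap (idm X) = idm (fobj X);
  fmap_comp : forall (X Y Z : C) (g : Hom Y Z) (f : Hom X Y),
    fmap (g ∘ f) = fmap g ∘ fmap f
}.
Arguments fmap {C D} F {X Y} f : rename.

Definition Op (C : Category) : Category :=
  {| Ob := C;
     Hom X Y := @Hom C Y X;
     idm X := idm X;
     comp X Y Z g f := @comp C Z Y X f g;
     comp_id_l X Y f := comp_id_r f;
     comp_id_r X Y f := comp_id_l f;
     comp_assoc W X Y Z h g f := eq_sym (comp_assoc f g h) |}.

Definition TypeCat : Category :=
  {| Ob := Type;
     Hom A B := A -> B;
     idm A := fun a => a;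
     comp A B C g f := fun a => g (f a);
     comp_id_l A B f := eq_refl;
     comp_id_r A B f := eq_refl;
     comp_assoc A B C D h g f := eq_refl |}.

Definition representable (C : Category) (F : Functor (Op C) TypeCat) : Prop :=
  exists (r : C) (alpha : forall c : C, @Hom C c r -> F c),
    (forall c, Bijective (alpha c)) /\
    (forall (c d : C) (k : @Hom C d c) (x : @Hom C c r),
        alpha d (x ∘ k) = fmap F (k : @Hom (Op C) c d) (alpha c x)).

Record SliceOb (B : Category) (I : B) := MkSliceOb {
  slice_dom : B;
  slice_map : Hom slice_dom I
}.

Record SliceHom (B : Category) (I : B) (a b : SliceOb I) := MkSliceHom {
  slice_mor : Hom (slice_dom a) (slice_dom b);
  slice_eq : slice_map b ∘ slice_mor = slice_map a
}.

Lemma slice_hom_ext (B : Category) (I : B) (a b : SliceOb I)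
  (k l : SliceHom a b) : slice_mor k = slice_mor l -> k = l.
Proof.
destruct k as [k ek], l as [l el]; simpl; intros <-.
f_equal; apply proof_irrelevance.
Qed.

Lemma slice_comp_eq (B : Category) (I : B) (a b c : SliceOb I)
  (l : SliceHom b c) (k : SliceHom a b) :
  slice_map c ∘ (slice_mor l ∘ slice_mor k) = slice_map a.
Proof. rewrite comp_assoc, (slice_eq l); apply slice_eq. Qed.

Definition Slice (B : Category) (I : B) : Category.
Proof.
refine {| Ob := SliceOb I;
          Hom := @SliceHom B I;
          idm a := MkSliceHom (comp_id_r (slice_map a));
          comp a b c l k := MkSliceHom (slice_comp_eq l k) |}.
- intros; apply slice_hom_ext, comp_id_l.
- intros; apply slice_hom_ext, comp_id_r.
- intros; apply slice_hom_ext, comp_assoc.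
Defined.

Definition is_cone (S C : Category) (D : Functor S C) (L : C)
  (pi : forall s : S, Hom L (D s)) : Prop :=
  forall (s t : S) (a : Hom s t), fmap D a ∘ pi s = pi t.

Definition is_limit (S C : Category) (D : Functor S C) (L : C)
  (pi : forall s : S, Hom L (D s)) : Prop :=
  is_cone pi /\
  forall (L' : C) (pi' : forall s : S, Hom L' (D s)), is_cone pi' ->
    exists! t : Hom L' L, forall s, pi s ∘ t = pi' s.

Definition finite_category (S : Category) : Prop :=
  Finite S /\ forall s t : S, Finite (Hom s t).

Definition has_finite_limits (C : Category) : Prop :=
  forall (S : Category) (D : Functor S C), finite_category S ->
    exists (L : C) (pi : forall s : S, Hom L (D s)), is_limit pi.

Section Fibrations.
Context {E B : Category}.

(** [over p f u] says that [p] sends [f : X -> Y] to [u : I -> J]; in particular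
    it forces [p X = I] and [p Y = J] (see [over_inv]).  Stating it as an
    inductive family avoids transporting [u] along these equalities. *)
Inductive over (p : Functor E B) (X Y : E) (f : Hom X Y) :
  forall I J : B, Hom I J -> Prop :=
| over_fmap : over p f (fmap p f).
Arguments over p {X Y} f {I J} u.

Variable p : Functor E B.

Lemma over_inv X Y (f : Hom X Y) I J (u : Hom I J) : over p f u ->
  exists (eX : p X = I) (eY : p Y = J),
    u = eq_rect _ (fun A => Hom A J)
          (eq_rect _ (fun A => Hom (p X) A) (fmap p f) _ eY) _ eX.
Proof. intros []; exists eq_refl, eq_refl; reflexivity. Qed.

Lemma over_id X I : p X = I -> over p (idm X) (idm I).
Proof. intros <-; rewrite <- fmap_id; constructor. Qed.

Lemma over_comp X Y Z (g : Hom Y Z) (f : Hom X Y) I J K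
  (v : Hom J K) (u : Hom I J) :
  over p g v -> over p f u -> over p (g ∘ f) (v ∘ u).
Proof.
intros Hg; revert X f I u; destruct Hg as []; intros X f I u Hf.
destruct (over_inv Hf) as [eX [eY ->]].
destruct eX; rewrite (proof_irrelevance _ eY eq_refl); simpl.
rewrite <- fmap_comp; constructor.
Qed.

Lemma over_dom X Y (f : Hom X Y) I J (u : Hom I J) : over p f u -> p X = I.
Proof. intros []; reflexivity. Qed.

Record FibOb (I : B) := MkFibOb {
  tot : E;
  tot_over : p tot = I
}.

Record FibHom (I : B) (X Y : FibOb I) := MkFibHom {
  mor : Hom (tot X) (tot Y);
  mor_over : over p mor (idm I)
}.

Lemma fib_hom_ext I (X Y : FibOb I) (g h : FibHom X Y) : mor g = mor h -> g = h.
Proof.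
destruct g as [g og], h as [h oh]; simpl; intros <-.
f_equal; apply proof_irrelevance.
Qed.

Lemma fib_comp_over I (X Y Z : FibOb I) (h : FibHom Y Z) (g : FibHom X Y) :
  over p (mor h ∘ mor g) (idm I).
Proof.
rewrite <- (comp_id_l (idm I)); apply over_comp; apply mor_over.
Qed.

Definition Fibre (I : B) : Category.
Proof.
refine {| Ob := FibOb I;
          Hom := @FibHom I;
          idm X := MkFibHom (over_id (tot_over X));
          comp X Y Z h g := MkFibHom (fib_comp_over h g) |}.
- intros; apply fib_hom_ext, comp_id_l.
- intros; apply fib_hom_ext, comp_id_r.
- intros; apply fib_hom_ext, comp_assoc.
Defined.

Definition cartesian (X Y : E) (phi : Hom X Y) (I J : B) (u : Hom I J) : Prop :=
  over p phi u /\
  forall (K : B) (w : Hom K I) (Z : E) (psi : Hom Z Y), over p psi (u ∘ w) ->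
    exists! chi : Hom Z X, over p chi w /\ phi ∘ chi = psi.

(** A cloven Grothendieck fibration is a functor [p] equipped with a [Cleavage];
    neither normality nor splitness is required. *)
Record Cleavage := MkCleavage {
  reindex : forall (I J : B) (u : Hom J I), Fibre I -> Fibre J;
  lift : forall (I J : B) (u : Hom J I) (X : Fibre I),
    Hom (tot (reindex u X)) (tot X);
  lift_cartesian : forall (I J : B) (u : Hom J I) (X : Fibre I),
    cartesian (lift u X) u
}.

End Fibrations.

Arguments over {E B} p {X Y} f {I J} u.
Arguments tot {E B p I} f.
Arguments mor {E B p I X Y} f.
Arguments Fibre {E B} p I.
Arguments Cleavage {E B} p.
Arguments reindex {E B p} c {I J} u X.
Arguments lift {E B p} c {I J} u X.

Section Reindexing.
Context {E B : Category} {p : Functor E B} (c : Cleavage p).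

Lemma lift_over I J (u : Hom J I) (X : Fibre p I) : over p (lift c u X) u.
Proof. apply lift_cartesian. Qed.

Lemma fill_exists I J K (u : Hom J I) (w : Hom K J) (X : Fibre p I) (Z : E)
  (psi : Hom Z (tot X)) : over p psi (u ∘ w) ->
  exists chi : Hom Z (tot (reindex c u X)), over p chi w /\ lift c u X ∘ chi = psi.
Proof.
intros H; destruct (proj2 (lift_cartesian c u X) _ _ _ _ H) as [chi [Hchi _]].
exists chi; exact Hchi.
Qed.

Definition fill I J K (u : Hom J I) (w : Hom K J) (X : Fibre p I) (Z : E)
  (psi : Hom Z (tot X)) (H : over p psi (u ∘ w)) : Hom Z (tot (reindex c u X)) :=
  proj1_sig (constructive_indefinite_description _ (fill_exists H)).

Lemma fill_over I J K (u : Hom J I) (w : Hom K J) (X : Fibre p I) (Z : E)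
  (psi : Hom Z (tot X)) (H : over p psi (u ∘ w)) : over p (fill H) w.
Proof.
exact (proj1 (proj2_sig (constructive_indefinite_description _ (fill_exists H)))).
Qed.

Lemma fill_lift I J K (u : Hom J I) (w : Hom K J) (X : Fibre p I) (Z : E)
  (psi : Hom Z (tot X)) (H : over p psi (u ∘ w)) : lift c u X ∘ fill H = psi.
Proof.
exact (proj2 (proj2_sig (constructive_indefinite_description _ (fill_exists H)))).
Qed.

Lemma lift_inj I J K (u : Hom J I) (w : Hom K J) (X : Fibre p I) (Z : E)
  (chi chi' : Hom Z (tot (reindex c u X))) :
  over p chi w -> over p chi' w ->
  lift c u X ∘ chi = lift c u X ∘ chi' -> chi = chi'.
Proof.
intros Hc Hc' e.
destruct (proj2 (lift_cartesian c u X) _ w Z (lift c u X ∘ chi)) as [x [_ Hx]].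
{ apply over_comp; [apply lift_over | exact Hc]. }
rewrite <- (Hx chi), <- (Hx chi'); auto.
Qed.

Lemma over_vertical_l I J (u : Hom J I) (A : E) (X Y : Fibre p I)
  (g : Hom X Y) (phi : Hom A (tot X)) : over p phi u -> over p (mor g ∘ phi) u.
Proof.
intros H; rewrite <- (comp_id_l u); apply over_comp; [apply mor_over | exact H].
Qed.

Lemma over_vertical_r I J (u : Hom J I) (A : E) (X Y : Fibre p J)
  (phi : Hom (tot Y) A) (g : Hom X Y) : over p phi u -> over p (phi ∘ mor g) u.
Proof.
intros H; rewrite <- (comp_id_r u); apply over_comp; [exact H | apply mor_over].
Qed.

Lemma over_id_r A X I J (phi : Hom A X) (u : Hom J I) :
  over p phi u -> over p phi (u ∘ idm J).
Proof. rewrite comp_id_r; auto. Qed.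

(** The vertical map into [u^* X] induced by a map into [X] over [u]. *)
Definition vfill I J (u : Hom J I) (Z : Fibre p J) (X : Fibre p I)
  (psi : Hom (tot Z) (tot X)) (H : over p psi u) : Hom Z (reindex c u X) :=
  @MkFibHom E B p J Z (reindex c u X) (fill (over_id_r H)) (fill_over (over_id_r H)).

Lemma vfill_lift I J (u : Hom J I) (Z : Fibre p J) (X : Fibre p I)
  (psi : Hom (tot Z) (tot X)) (H : over p psi u) :
  lift c u X ∘ mor (vfill H) = psi.
Proof. apply fill_lift. Qed.

Lemma vlift_inj I J (u : Hom J I) (Z : Fibre p J) (X : Fibre p I)
  (g h : Hom Z (reindex c u X)) :
  lift c u X ∘ mor g = lift c u X ∘ mor h -> g = h.
Proof. intros e; apply fib_hom_ext; eapply lift_inj; eauto; apply mor_over. Qed.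

Definition reindex_hom I J (u : Hom J I) (X Y : Fibre p I) (g : Hom X Y) :
  Hom (reindex c u X) (reindex c u Y) :=
  vfill (over_vertical_l g (lift_over u X)).

Lemma reindex_hom_lift I J (u : Hom J I) (X Y : Fibre p I) (g : Hom X Y) :
  lift c u Y ∘ mor (reindex_hom u g) = mor g ∘ lift c u X.
Proof. apply vfill_lift. Qed.

Lemma over_eq A X I J (phi : Hom A X) (u v : Hom J I) :
  u = v -> over p phi u -> over p phi v.
Proof. intros <-; auto. Qed.

(** For [s' = s ∘ k], the canonical vertical maps between [s'^* X] and
    [k^* (s^* X)], and the canonical map [s'^* X -> s^* X] over [k]. Keeping
    [s'] and the equation separate allows [s'] to be equal to [s ∘ k] only
    propositionally, as for maps in a slice. *)
Definition compare I K K' (s : Hom K I) (k : Hom K' K) (s' : Hom K' I)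
  (e : s ∘ k = s') (X : Fibre p I) :
  Hom (tot (reindex c s' X)) (tot (reindex c s X)) :=
  fill (over_eq (eq_sym e) (lift_over s' X)).

Lemma compare_over I K K' (s : Hom K I) (k : Hom K' K) (s' : Hom K' I)
  (e : s ∘ k = s') (X : Fibre p I) : over p (compare e X) k.
Proof. apply fill_over. Qed.

Definition reindex_split I K K' (s : Hom K I) (k : Hom K' K) (s' : Hom K' I)
  (e : s ∘ k = s') (X : Fibre p I) :
  Hom (reindex c s' X) (reindex c k (reindex c s X)) :=
  vfill (compare_over e X).

Definition reindex_merge I K K' (s : Hom K I) (k : Hom K' K) (s' : Hom K' I)
  (e : s ∘ k = s') (X : Fibre p I) :
  Hom (reindex c k (reindex c s X)) (reindex c s' X) :=
  vfill (over_eq e (over_comp (lift_over s X) (lift_over k (reindex c s X)))).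

(** [k^*] on a vertical map [g : s^* X -> t^* Y], regarded as a map
    [(s ∘ k)^* X -> (t ∘ k)^* Y] along the canonical isomorphisms. *)
Definition restrict I J K K' (X : Fibre p I) (Y : Fibre p J)
  (s : Hom K I) (t : Hom K J) (k : Hom K' K) (s' : Hom K' I) (t' : Hom K' J)
  (es : s ∘ k = s') (et : t ∘ k = t')
  (g : Hom (reindex c s X) (reindex c t Y)) :
  Hom (reindex c s' X) (reindex c t' Y) :=
  reindex_merge et Y ∘ reindex_hom k g ∘ reindex_split es X.

Lemma compare_lift I K K' (s : Hom K I) (k : Hom K' K) (s' : Hom K' I)
  (e : s ∘ k = s') (X : Fibre p I) : lift c s X ∘ compare e X = lift c s' X.
Proof. apply fill_lift. Qed.

Lemma reindex_split_lift I K K' (s : Hom K I) (k : Hom K' K) (s' : Hom K' I)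
  (e : s ∘ k = s') (X : Fibre p I) :
  lift c k (reindex c s X) ∘ mor (reindex_split e X) = compare e X.
Proof. exact (vfill_lift _). Qed.

Lemma reindex_merge_lift I K K' (s : Hom K I) (k : Hom K' K) (s' : Hom K' I)
  (e : s ∘ k = s') (X : Fibre p I) :
  lift c s' X ∘ mor (reindex_merge e X) = lift c s X ∘ lift c k (reindex c s X).
Proof. exact (vfill_lift _). Qed.

Lemma restrict_lift I J K K' (X : Fibre p I) (Y : Fibre p J)
  (s : Hom K I) (t : Hom K J) (k : Hom K' K) (s' : Hom K' I) (t' : Hom K' J)
  (es : s ∘ k = s') (et : t ∘ k = t')
  (g : Hom (reindex c s X) (reindex c t Y)) :
  lift c t' Y ∘ mor (restrict es et g) = lift c t Y ∘ mor g ∘ compare es X.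
Proof.
change (mor (restrict es et g)) with
  (mor (reindex_merge et Y) ∘ mor (reindex_hom k g) ∘ mor (reindex_split es X)).
rewrite !comp_assoc, reindex_merge_lift, <- (comp_assoc (lift c t Y)),
  reindex_hom_lift, <- !comp_assoc, reindex_split_lift; reflexivity.
Qed.

Lemma restrict_compare I J K K' (X : Fibre p I) (Y : Fibre p J)
  (s : Hom K I) (t : Hom K J) (k : Hom K' K) (s' : Hom K' I) (t' : Hom K' J)
  (es : s ∘ k = s') (et : t ∘ k = t')
  (g : Hom (reindex c s X) (reindex c t Y)) :
  compare et Y ∘ mor (restrict es et g) = mor g ∘ compare es X.
Proof.
eapply lift_inj.
- apply over_vertical_r, compare_over.
- apply over_vertical_l, compare_over.
- rewrite !comp_assoc, compare_lift; apply restrict_lift.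
Qed.

Lemma restrict_id I J K (X : Fibre p I) (Y : Fibre p J)
  (s : Hom K I) (t : Hom K J) (es : s ∘ idm K = s) (et : t ∘ idm K = t)
  (g : Hom (reindex c s X) (reindex c t Y)) : restrict es et g = g.
Proof.
apply vlift_inj; rewrite restrict_lift.
replace (compare es X) with (idm (tot (reindex c s X))).
- apply comp_id_r.
- eapply lift_inj; [apply over_id, tot_over | apply compare_over |].
  rewrite compare_lift; apply comp_id_r.
Qed.

Lemma restrict_restrict I J K K' K'' (X : Fibre p I) (Y : Fibre p J)
  (s : Hom K I) (t : Hom K J) (k : Hom K' K) (s' : Hom K' I) (t' : Hom K' J)
  (k' : Hom K'' K') (s'' : Hom K'' I) (t'' : Hom K'' J)
  (es : s ∘ k = s') (et : t ∘ k = t') (es' : s' ∘ k' = s'') (et' : t' ∘ k' = t'')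
  (es'' : s ∘ (k ∘ k') = s'') (et'' : t ∘ (k ∘ k') = t'')
  (g : Hom (reindex c s X) (reindex c t Y)) :
  restrict es' et' (restrict es et g) = restrict es'' et'' g.
Proof.
apply vlift_inj; rewrite !restrict_lift, <- comp_assoc.
f_equal; eapply lift_inj.
- apply over_comp; apply compare_over.
- apply compare_over.
- rewrite comp_assoc, !compare_lift; reflexivity.
Qed.

Lemma restrict_comp I1 I2 I3 K K'
  (X : Fibre p I1) (Y : Fibre p I2) (Z : Fibre p I3)
  (r : Hom K I1) (s : Hom K I2) (t : Hom K I3) (k : Hom K' K)
  (r' : Hom K' I1) (s' : Hom K' I2) (t' : Hom K' I3)
  (er : r ∘ k = r') (es : s ∘ k = s') (et : t ∘ k = t')
  (h : Hom (reindex c s Y) (reindex c t Z)) (g : Hom (reindex c r X) (reindex c s Y)) :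
  restrict er et (h ∘ g) = restrict es et h ∘ restrict er es g.
Proof.
apply vlift_inj.
change (mor (restrict es et h ∘ restrict er es g)) with
  (mor (restrict es et h) ∘ mor (restrict er es g)).
rewrite comp_assoc, !restrict_lift.
change (mor (h ∘ g)) with (mor h ∘ mor g).
rewrite <- !comp_assoc, restrict_compare; reflexivity.
Qed.

Lemma restrict_reindex I K K' (X Y : Fibre p I) (s : Hom K I) (k : Hom K' K)
  (s' : Hom K' I) (es : s ∘ k = s') (g : Hom X Y) :
  restrict es es (reindex_hom s g) = reindex_hom s' g.
Proof.
apply vlift_inj; rewrite restrict_lift, !reindex_hom_lift, <- comp_assoc.
f_equal; apply compare_lift.
Qed.

(** The presheaf [(u : J -> I) |-> E_J(u^* X, u^* Y)]. *)
Definition hom_presheaf (I : B) (X Y : Fibre p I) : Functor (Op (Slice I)) TypeCat.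
Proof.
refine {| fobj := (fun a : SliceOb I =>
            Hom (reindex c (slice_map a) X) (reindex c (slice_map a) Y))
            : Op (Slice I) -> TypeCat;
          fmap a b (k : SliceHom b a) :=
            fun g => restrict (slice_eq k) (slice_eq k) g |}.
- intros a; apply functional_extensionality; intros g; apply restrict_id.
- intros a b d l k; apply functional_extensionality; intros g; simpl.
  symmetry; apply restrict_restrict.
Defined.

Definition locally_small : Prop :=
  forall (I : B) (X Y : Fibre p I), representable (hom_presheaf X Y).

Section Lifting.
Context {I J : B} {U V : Fibre p I} (m : Hom U V) {X Y : Fibre p J} (f : Hom X Y).

Record LiftFamily (K : B) := MkLiftFamily {
  lf_s : Hom K I;
  lf_t : Hom K J;
  lf_top : Hom (reindex c lf_s U) (reindex c lf_t X);
  lf_bot : Hom (reindex c lf_s V) (reindex c lf_t Y);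
  lf_comm : reindex_hom lf_t f ∘ lf_top = lf_bot ∘ reindex_hom lf_s m
}.

Definition is_solution (K : B) (F : LiftFamily K)
  (j : Hom (reindex c (lf_s F) V) (reindex c (lf_t F) X)) : Prop :=
  j ∘ reindex_hom (lf_s F) m = lf_top F /\ reindex_hom (lf_t F) f ∘ j = lf_bot F.

Definition has_solution (K : B) (F : LiftFamily K) : Prop :=
  exists j, is_solution (F := F) j.

Lemma restrict_family_comm (K K' : B) (k : Hom K' K) (F : LiftFamily K) :
  reindex_hom (lf_t F ∘ k) f ∘ restrict eq_refl eq_refl (lf_top F) =
  restrict eq_refl eq_refl (lf_bot F) ∘ reindex_hom (lf_s F ∘ k) m.
Proof.
rewrite <- (restrict_reindex (eq_refl (lf_t F ∘ k))).
rewrite <- (restrict_reindex (eq_refl (lf_s F ∘ k))).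
rewrite <- !restrict_comp, lf_comm; reflexivity.
Qed.

Definition restrict_family (K K' : B) (k : Hom K' K) (F : LiftFamily K) :
  LiftFamily K' :=
  {| lf_s := lf_s F ∘ k;
     lf_t := lf_t F ∘ k;
     lf_top := restrict eq_refl eq_refl (lf_top F);
     lf_bot := restrict eq_refl eq_refl (lf_bot F);
     lf_comm := restrict_family_comm k F |}.

Definition coherent_choice
  (sol : forall (K : B) (F : LiftFamily K),
      Hom (reindex c (lf_s F) V) (reindex c (lf_t F) X)) : Prop :=
  (forall K (F : LiftFamily K), is_solution (sol K F)) /\
  (forall (K K' : B) (k : Hom K' K) (F : LiftFamily K),
      sol K' (restrict_family k F) = restrict eq_refl eq_refl (sol K F)).

Definition universal_family (H : B) (F : LiftFamily H) : Prop :=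
  forall (K' : B) (G : LiftFamily K'),
    exists! t : Hom K' H, restrict_family t F = G.

End Lifting.
End Reindexing.

Arguments LiftFamily {E B p} c {I J U V} m {X Y} f K.

(* Main.v *)
Require Import Defs.
From Stdlib Require Import List FinFun ClassicalEpsilon.

Set Implicit Arguments.
Unset Strict Implicit.
Unset Printing Implicit Defensive.
Local Open Scope cat_scope.

(** The hom object of [V(E)] is the pullback of
    [Hom(U, X) -> Hom(U, Y) <- Hom(V, Y)] (postcompose with [f], precompose with
    [m]), where [Hom(A, Z)] for [A] over [I] and [Z] over [J] comes from local
    smallness applied to the reindexings of [A] and [Z] to [I × J]. A solution
    of the universal family then restricts to a solution of every family along
    its unique classifying map, and uniqueness of classifying maps makes this
    choice coherent. *)

(** * Terminal object, pullbacks and binary products in the base *)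

Section FiniteLimits.
Context (B : Category) (B_lim : has_finite_limits B).

Definition EmptyCat : Category.
Proof.
refine {| Ob := Empty_set; Hom _ _ := Empty_set;
          idm X := X; comp X _ _ _ _ := X |}; intros [].
Defined.

(** The limit of the empty diagram: every object carries exactly one cone over it. *)
Lemma terminal_exists : exists T : B, forall K : B, exists! k : Hom K T, True.
Proof.
pose (D := {| fobj := (fun x : Empty_set => match x with end) : EmptyCat -> B;
              fmap x y _ := match x with end;
              fmap_id x := match x with end;
              fmap_comp x _ _ _ _ := match x with end |}).
destruct (B_lim D) as [T [pi [_ HT]]].
{ split; [exists nil; intros [] | intros []]. }
exists T; intros K.
destruct (HT K (fun s : EmptyCat => match s with end)) as [k [_ Hk]]; [intros [] |].
exists k; split; [trivial | intros k' _; apply Hk; intros []].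
Qed.

(** [Some true] and [Some false] are the feet of the cospan, [None] its apex. *)
Definition cospan_hom (x y : option bool) : Type :=
  match x, y with
  | _, None | Some true, Some true | Some false, Some false => unit
  | _, _ => Empty_set
  end.

Definition cospan_id (x : option bool) : cospan_hom x x :=
  match x with Some true | Some false | None => tt end.

Definition cospan_comp (x y z : option bool) :
  cospan_hom y z -> cospan_hom x y -> cospan_hom x z.
Proof. destruct x as [[]|], y as [[]|], z as [[]|]; intros [] []; exact tt. Defined.

Definition CospanCat : Category.
Proof.
refine {| Ob := option bool; Hom := cospan_hom;
          idm := cospan_id; comp := cospan_comp |}.
- intros [[]|] [[]|] []; reflexivity.
- intros [[]|] [[]|] []; reflexivity.
- intros [[]|] [[]|] [[]|] [[]|] [] [] []; reflexivity.
Defined.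

Lemma CospanCat_finite : finite_category CospanCat.
Proof.
split.
- exists (Some true :: Some false :: None :: nil).
  intros [[]|]; simpl; tauto.
- intros [[]|] [[]|]; simpl;
    first [exists nil; intros []; fail | exists (tt :: nil); intros []; simpl; tauto].
Qed.

Definition cospan_functor (P Q R : B) (f : Hom P R) (g : Hom Q R) :
  Functor CospanCat B.
Proof.
refine {| fobj := (fun x : option bool =>
            match x with Some true => P | Some false => Q | None => R end)
            : CospanCat -> B;
          fmap := fun x y : option bool =>
            match x, y return cospan_hom x y ->
              Hom (match x with Some true => P | Some false => Q | None => R end)
                  (match y with Some true => P | Some false => Q | None => R end)
            with
            | Some true, Some true => fun _ => idm P
            | Some false, Some false => fun _ => idm Q
            | None, None => fun _ => idm R
            | Some true, None => fun _ => f
            | Some false, None => fun _ => g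
            | _, _ => fun e => match e with end
            end |}.
- intros [[]|]; reflexivity.
- intros [[]|] [[]|] [[]|] [] []; simpl; rewrite ?comp_id_l, ?comp_id_r; reflexivity.
Defined.

Lemma pullback_exists (P Q R : B) (f : Hom P R) (g : Hom Q R) :
  exists (L : B) (a : Hom L P) (b : Hom L Q), f ∘ a = g ∘ b /\
    forall (K : B) (a' : Hom K P) (b' : Hom K Q), f ∘ a' = g ∘ b' ->
      exists! t : Hom K L, a ∘ t = a' /\ b ∘ t = b'.
Proof.
destruct (B_lim (cospan_functor f g) CospanCat_finite) as [L [pi [Hpi HL]]].
pose proof (Hpi (Some true) None tt) as e1.
pose proof (Hpi (Some false) None tt) as e2.
simpl in e1, e2.
exists L, (pi (Some true)), (pi (Some false)); split.
{ rewrite e1; symmetry; exact e2. }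
intros K a' b' e.
(* The leg at the apex is forced by the cone condition, so a cone is just a commuting pair. *)
pose (pi' := (fun x : option bool =>
  match x return Hom K (cospan_functor f g x) with
  | Some true => a' | Some false => b' | None => f ∘ a' end)
  : forall x : CospanCat, Hom K (cospan_functor f g x)).
destruct (HL K pi') as [t [Ht Hu]].
{ intros [[]|] [[]|] []; simpl; rewrite ?comp_id_l; auto. }
exists t; split.
- split; [exact (Ht (Some true)) | exact (Ht (Some false))].
- intros t' [<- <-]; apply Hu; intros [[]|]; simpl; auto.
  rewrite comp_assoc; f_equal; symmetry; exact e1.
Qed.

(** A pullback over the terminal object, where every pair of maps commutes. *)
Lemma product_exists (I J : B) :
  exists (P : B) (a : Hom P I) (b : Hom P J),
    forall (K : B) (a' : Hom K I) (b' : Hom K J),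
      exists! t : Hom K P, a ∘ t = a' /\ b ∘ t = b'.
Proof.
destruct terminal_exists as [T HT].
destruct (HT I) as [i _], (HT J) as [j _].
destruct (pullback_exists i j) as [P [a [b [_ H]]]].
exists P, a, b; intros K a' b'; apply H.
destruct (HT K) as [k [_ Hk]].
rewrite <- (Hk (i ∘ a')), <- (Hk (j ∘ b')); auto.
Qed.

End FiniteLimits.

(** * Canonical isomorphisms of reindexings, and hom objects across two bases *)

Section Reindexing.
Context {E B : Category} {p : Functor E B} (c : Cleavage p).

(** Cancel the cartesian lifts of [k] and then of [s]. With the converse below, [reindex_split] and
    [reindex_merge] are mutually inverse. *)
Lemma reindex_split_merge I K K' (s : Hom K I) (k : Hom K' K) (s' : Hom K' I)
  (e : s ∘ k = s') (X : Fibre p I) :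
  reindex_split c e X ∘ reindex_merge c e X = idm _.
Proof.
apply vlift_inj.
change (mor (reindex_split c e X ∘ reindex_merge c e X)) with
  (mor (reindex_split c e X) ∘ mor (reindex_merge c e X)).
rewrite comp_assoc, reindex_split_lift.
change (mor (idm (reindex c k (reindex c s X)))) with
  (idm (tot (reindex c k (reindex c s X)))).
rewrite comp_id_r.
eapply lift_inj; [apply over_vertical_r, compare_over | apply lift_over |].
rewrite comp_assoc, compare_lift; apply reindex_merge_lift.
Qed.

Lemma reindex_merge_split I K K' (s : Hom K I) (k : Hom K' K) (s' : Hom K' I)
  (e : s ∘ k = s') (X : Fibre p I) :
  reindex_merge c e X ∘ reindex_split c e X = idm _.
Proof.
apply vlift_inj.
change (mor (reindex_merge c e X ∘ reindex_split c e X)) with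
  (mor (reindex_merge c e X) ∘ mor (reindex_split c e X)).
rewrite comp_assoc, reindex_merge_lift, <- comp_assoc, reindex_split_lift,
  compare_lift.
symmetry; apply comp_id_r.
Qed.

(** Both sides lie over [k]. Cancelling the lifts of [r] and then of [a] reduces each to the lift of
    [s']. *)
Lemma split_compare I P R K (a : Hom P I) (r : Hom R P) (k : Hom K R)
  (u : Hom K P) (s : Hom R I) (s' : Hom K I) (e : r ∘ k = u)
  (ea : a ∘ r = s) (ea' : a ∘ u = s') (es : s ∘ k = s') (A : Fibre p I) :
  mor (reindex_split c ea A) ∘ compare c es A =
  compare c e (reindex c a A) ∘ mor (reindex_split c ea' A).
Proof.
eapply lift_inj.
- apply over_vertical_l, compare_over.
- apply over_vertical_r, compare_over.
- rewrite !comp_assoc, compare_lift, !reindex_split_lift.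
  eapply lift_inj.
  + apply over_comp; apply compare_over.
  + eapply over_eq; [symmetry; exact e | apply compare_over].
  + rewrite comp_assoc, !compare_lift; reflexivity.
Qed.

(** Lets restriction be computed before or after identifying maps between iterated reindexings with
    maps between reindexings along composites. *)
Lemma restrict_conj I J P R K (a : Hom P I) (b : Hom P J) (r : Hom R P)
  (k : Hom K R) (u : Hom K P) (s : Hom R I) (t : Hom R J)
  (s' : Hom K I) (t' : Hom K J) (e : r ∘ k = u)
  (ea : a ∘ r = s) (eb : b ∘ r = t) (ea' : a ∘ u = s') (eb' : b ∘ u = t')
  (es : s ∘ k = s') (et : t ∘ k = t') (A : Fibre p I) (Z : Fibre p J)
  (g : Hom (reindex c r (reindex c a A)) (reindex c r (reindex c b Z))) :
  restrict es et (reindex_merge c eb Z ∘ g ∘ reindex_split c ea A) =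
  reindex_merge c eb' Z ∘ restrict e e g ∘ reindex_split c ea' A.
Proof.
apply vlift_inj; rewrite restrict_lift.
change (mor (reindex_merge c eb Z ∘ g ∘ reindex_split c ea A)) with
  (mor (reindex_merge c eb Z) ∘ mor g ∘ mor (reindex_split c ea A)).
change (mor (reindex_merge c eb' Z ∘ restrict e e g ∘ reindex_split c ea' A)) with
  (mor (reindex_merge c eb' Z) ∘ mor (restrict e e g)
     ∘ mor (reindex_split c ea' A)).
rewrite !comp_assoc, !reindex_merge_lift.
rewrite <- (comp_assoc (lift c b Z) (lift c u _)), restrict_lift.
rewrite <- !comp_assoc, (split_compare e ea ea' es); reflexivity.
Qed.

(** A pair [s'], [t'] is one map [u] into the product [P], and conjugation by the canonical
    isomorphisms turns [g'] into an element of the hom presheaf over [P] at [u]. The representing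
    object of that presheaf is therefore the hom object. *)
Lemma hom_object_exists (B_lim : has_finite_limits B) (p_ls : locally_small c)
  (I J : B) (A : Fibre p I) (Z : Fibre p J) :
  exists (H : B) (s : Hom H I) (t : Hom H J)
    (g : Hom (reindex c s A) (reindex c t Z)),
    forall (K : B) (s' : Hom K I) (t' : Hom K J)
      (g' : Hom (reindex c s' A) (reindex c t' Z)),
      exists! k : Hom K H,
        exists (es : s ∘ k = s') (et : t ∘ k = t'), restrict es et g = g'.
Proof.
destruct (product_exists B_lim I J) as [P [a [b HP]]].
destruct (p_ls P (reindex c a A) (reindex c b Z)) as [[R r] [alpha [Hbij Hnat]]].
pose (r0 := MkSliceOb r : Slice P).
(* The Yoneda element: by naturality, [alpha] sends each slice map to the restriction of [g0] along
   it. *)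
pose (g0 := alpha r0 (idm r0)
  : Hom (reindex c r (reindex c a A)) (reindex c r (reindex c b Z))).
assert (Hg0 : forall (K : B) (u : Hom K P) (k : Hom K R) (e : r ∘ k = u),
  alpha (MkSliceOb u) (@MkSliceHom B P (MkSliceOb u) r0 k e) = restrict e e g0).
{ intros K u k e; pose (x := @MkSliceHom B P (MkSliceOb u) r0 k e).
  refine (eq_trans _ (Hnat r0 (MkSliceOb u) x (idm r0))).
  f_equal; symmetry; apply (@comp_id_l (Slice P)). }
exists R, (a ∘ r), (b ∘ r),
  (reindex_merge c eq_refl Z ∘ g0 ∘ reindex_split c eq_refl A).
intros K s' t' g'.
destruct (HP K s' t') as [u [[ea eb] Hu]].
destruct (Hbij (MkSliceOb u)) as [beta [Hba Hab]].
pose (gg := reindex_split c eb Z ∘ g' ∘ reindex_merge c ea A).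
destruct (beta gg) as [k0 e] eqn:Hx; simpl in k0, e.
assert (Hgg : restrict e e g0 = gg).
{ rewrite <- Hg0; exact (eq_trans (f_equal _ (eq_sym Hx)) (Hab gg)). }
exists k0; split.
- assert (es : a ∘ r ∘ k0 = s') by (rewrite <- comp_assoc, e; exact ea).
  assert (et : b ∘ r ∘ k0 = t') by (rewrite <- comp_assoc, e; exact eb).
  exists es, et.
  rewrite (restrict_conj e eq_refl eq_refl ea eb), Hgg; unfold gg.
  rewrite !comp_assoc, reindex_merge_split, comp_id_l, <- comp_assoc,
    reindex_merge_split; apply comp_id_r.
- intros k [es [et Hk]].
  (* A competitor [k] is only known to commute with the maps to [I] and [J]; uniqueness for the
     product makes it a map of the slice over [P]. *)
  assert (ek : r ∘ k = u).
  { symmetry; apply Hu; rewrite !comp_assoc; auto. }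
  assert (Hkk : restrict ek ek g0 = gg).
  { unfold gg; rewrite <- Hk, (restrict_conj ek eq_refl eq_refl ea eb).
    rewrite !comp_assoc, reindex_split_merge, comp_id_l, <- comp_assoc,
      reindex_split_merge; symmetry; apply comp_id_r. }
  (* Now [gg] is [alpha] of the slice map given by [k], so [beta gg] recovers [k]. *)
  rewrite <- Hkk, <- (Hg0 _ _ _ ek) in Hx.
  pose proof (eq_trans (eq_sym (Hba _)) Hx) as Hx'.
  exact (eq_sym (f_equal (@slice_mor _ _ _ _) Hx')).
Qed.

(** * Universal family of lifting problems and coherent solutions *)

Section Lifting.
Context {I J : B} {U V : Fibre p I} (m : Hom U V) {X Y : Fibre p J} (f : Hom X Y).

(** Replaces equality of dependent records by equations between their sides: the equalities of base
    maps are absorbed by [restrict], so nothing is transported. *)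
Lemma restrict_family_eq (K K' : B) (k : Hom K' K) (F : LiftFamily c m f K)
  (G : LiftFamily c m f K') :
  restrict_family k F = G <->
  exists (es : lf_s F ∘ k = lf_s G) (et : lf_t F ∘ k = lf_t G),
    restrict es et (lf_top F) = lf_top G /\ restrict es et (lf_bot F) = lf_bot G.
Proof.
split.
- intros <-; exists eq_refl, eq_refl; auto.
- destruct G as [s t top bot comm]; simpl; intros [es [et [e1 e2]]].
  unfold restrict_family.
  destruct es, et, e1, e2; f_equal; apply proof_irrelevance.
Qed.

Lemma restrict_family_comp (K K' K'' : B) (k : Hom K' K) (k' : Hom K'' K')
  (F : LiftFamily c m f K) :
  restrict_family (k ∘ k') F = restrict_family k' (restrict_family k F).
Proof.
apply restrict_family_eq; simpl.
exists (comp_assoc _ _ _), (comp_assoc _ _ _).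
split; symmetry; apply restrict_restrict.
Qed.

(** Restriction preserves composites and reindexings of [m] and [f], hence both triangles. *)
Lemma restrict_solution (K K' : B) (k : Hom K' K) (F : LiftFamily c m f K)
  (G : LiftFamily c m f K') (es : lf_s F ∘ k = lf_s G) (et : lf_t F ∘ k = lf_t G)
  (j : Hom (reindex c (lf_s F) V) (reindex c (lf_t F) X)) :
  restrict_family k F = G -> is_solution (F := F) j ->
  is_solution (F := G) (restrict es et j).
Proof.
intros <-; simpl in es, et.
rewrite (proof_irrelevance _ es eq_refl), (proof_irrelevance _ et eq_refl).
intros [e1 e2]; split; cbn [restrict_family lf_s lf_t lf_top lf_bot].
- rewrite <- (restrict_reindex c (eq_refl (lf_s F ∘ k)) m), <- restrict_comp, e1.
  reflexivity.
- rewrite <- (restrict_reindex c (eq_refl (lf_t F ∘ k)) f), <- restrict_comp, e2.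
  reflexivity.
Qed.

(** The two components of a map into the pullback classify a top and a bottom side; their agreement
    in [H3] says that the square commutes. *)
Lemma universal_family_exists (B_lim : has_finite_limits B)
  (p_ls : locally_small c) :
  exists (H : B) (F : LiftFamily c m f H), universal_family F.
Proof.
destruct (hom_object_exists B_lim p_ls U X) as [H1 [s1 [t1 [g1 u1]]]].
destruct (hom_object_exists B_lim p_ls V Y) as [H2 [s2 [t2 [g2 u2]]]].
destruct (hom_object_exists B_lim p_ls U Y) as [H3 [s3 [t3 [g3 u3]]]].
(* Here [phi] is postcomposition with [f] and [psi] precomposition with [m], each obtained by
   classifying the composite with a generic map. *)
destruct (u3 _ _ _ (reindex_hom c t1 f ∘ g1)) as [phi [[ps [pt Hphi]] _]].
destruct (u3 _ _ _ (g2 ∘ reindex_hom c s2 m)) as [psi [[qs [qt Hpsi]] _]].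
destruct (pullback_exists B_lim phi psi) as [L [k1 [k2 [ek HL]]]].
(* Since [phi] and [psi] respect the maps to [I] and [J], the two generic maps live over the same
   pair of maps on [L]. *)
assert (es : s2 ∘ k2 = s1 ∘ k1).
{ rewrite <- qs, <- ps, <- !comp_assoc, ek; reflexivity. }
assert (et : t2 ∘ k2 = t1 ∘ k1).
{ rewrite <- qt, <- pt, <- !comp_assoc, ek; reflexivity. }
(* Both composites are restrictions of [g3], along [phi ∘ k1] and [psi ∘ k2], which are equal. *)
assert (Hcomm : reindex_hom c (t1 ∘ k1) f ∘ restrict eq_refl eq_refl g1 =
                restrict es et g2 ∘ reindex_hom c (s1 ∘ k1) m).
{ rewrite <- (restrict_reindex c (eq_refl (t1 ∘ k1)) f).
  rewrite <- (restrict_reindex c es m).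
  rewrite <- !restrict_comp, <- Hphi, <- Hpsi.
  assert (as1 : s3 ∘ (phi ∘ k1) = s1 ∘ k1) by (rewrite comp_assoc, ps; auto).
  assert (at1 : t3 ∘ (phi ∘ k1) = t1 ∘ k1) by (rewrite comp_assoc, pt; auto).
  rewrite (restrict_restrict ps pt eq_refl eq_refl as1 at1).
  revert as1 at1; rewrite ek; intros as1 at1.
  symmetry; apply restrict_restrict. }
exists L, (MkLiftFamily Hcomm); intros K G.
destruct (u1 _ _ _ (lf_top G)) as [l1 [[as1 [at1 Htop]] Hl1]].
destruct (u2 _ _ _ (lf_bot G)) as [l2 [[as2 [at2 Hbot]] Hl2]].
(* Both maps classify the diagonal of the square [G], one through its top side and the other through
   its bottom side. *)
assert (el : phi ∘ l1 = psi ∘ l2).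
{ destruct (u3 _ _ _ (reindex_hom c (lf_t G) f ∘ lf_top G)) as [w [_ Hw]].
  rewrite <- (Hw (phi ∘ l1)), <- (Hw (psi ∘ l2)); auto.
  - assert (as3 : s3 ∘ (psi ∘ l2) = lf_s G) by (rewrite comp_assoc, qs; auto).
    assert (at3 : t3 ∘ (psi ∘ l2) = lf_t G) by (rewrite comp_assoc, qt; auto).
    exists as3, at3.
    rewrite <- (restrict_restrict qs qt as2 at2), Hpsi, (restrict_comp as2 as2 at2),
      Hbot, restrict_reindex; symmetry; apply lf_comm.
  - assert (as3 : s3 ∘ (phi ∘ l1) = lf_s G) by (rewrite comp_assoc, ps; auto).
    assert (at3 : t3 ∘ (phi ∘ l1) = lf_t G) by (rewrite comp_assoc, pt; auto).
    exists as3, at3.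
    rewrite <- (restrict_restrict ps pt as1 at1), Hphi, (restrict_comp as1 at1 at1),
      Htop, restrict_reindex; reflexivity. }
destruct (HL _ _ _ el) as [l [[e1 e2] Hl]].
exists l; split.
- apply restrict_family_eq; simpl.
  destruct e1, e2.
  assert (bs : s1 ∘ k1 ∘ l = lf_s G) by (rewrite <- comp_assoc; exact as1).
  assert (bt : t1 ∘ k1 ∘ l = lf_t G) by (rewrite <- comp_assoc; exact at1).
  exists bs, bt; rewrite <- Htop, <- Hbot; split; apply restrict_restrict.
- intros l' Hl'; apply restrict_family_eq in Hl'; simpl in Hl'.
  destruct Hl' as [bs [bt [Htop' Hbot']]].
  apply Hl; split; symmetry.
  + apply Hl1.
    assert (bs' : s1 ∘ (k1 ∘ l') = lf_s G) by (rewrite comp_assoc; exact bs).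
    assert (bt' : t1 ∘ (k1 ∘ l') = lf_t G) by (rewrite comp_assoc; exact bt).
    exists bs', bt'; rewrite <- Htop'; symmetry; apply restrict_restrict.
  + apply Hl2.
    assert (bs' : s2 ∘ (k2 ∘ l') = lf_s G) by (rewrite comp_assoc, es; exact bs).
    assert (bt' : t2 ∘ (k2 ∘ l') = lf_t G) by (rewrite comp_assoc, et; exact bt).
    exists bs', bt'; rewrite <- Hbot'; symmetry; apply restrict_restrict.
Qed.

Lemma universal_solution_coherent (H : B) (F : LiftFamily c m f H) :
  universal_family F -> has_solution F ->
  exists sol, coherent_choice (c := c) (m := m) (f := f) sol.
Proof.
intros HF [j Hj].
(* A relation, so that [j'] has the type prescribed by [G] although the classifying map yields [G]
   only up to a propositional equality. *)
pose (induced K (G : LiftFamily c m f K)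
        (j' : Hom (reindex c (lf_s G) V) (reindex c (lf_t G) X)) :=
  exists (t : Hom K H) (es : lf_s F ∘ t = lf_s G) (et : lf_t F ∘ t = lf_t G),
    restrict_family t F = G /\ j' = restrict es et j).
assert (Hex : forall K G, exists j', @induced K G j').
{ intros K G; destruct (HF K G) as [t [e _]].
  destruct (proj1 (restrict_family_eq _ _ _) e) as [es [et _]].
  exists (restrict es et j), t, es, et; auto. }
pose (sol K (G : LiftFamily c m f K) :=
  proj1_sig (constructive_indefinite_description _ (Hex K G))).
assert (Hsol : forall K G, induced K G (sol K G)).
{ intros K G; exact (proj2_sig (constructive_indefinite_description _ (Hex K G))). }
exists sol; split.
- intros K G; destruct (Hsol K G) as [t [es [et [e ->]]]].
  apply restrict_solution; assumption.
- intros K K' k G.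
  destruct (Hsol K G) as [t [es [et [e ->]]]].
  destruct (Hsol K' (restrict_family k G)) as [t' [es' [et' [e' ->]]]].
  (* Both classify the restricted family; coherence is then functoriality of restriction. *)
  assert (et0 : t' = t ∘ k).
  { destruct (HF K' (restrict_family k G)) as [w [_ Hw]].
    rewrite <- (Hw t'), <- (Hw (t ∘ k)); auto.
    rewrite restrict_family_comp, e; reflexivity. }
  subst t'; symmetry; apply restrict_restrict.
Qed.

End Lifting.
End Reindexing.

(** Existence of a universal family is asserted separately, so that the equivalences, stated for an
    arbitrary universal family, are not vacuous. *)
Theorem proposition3p2p5 (E B : Category) (p : Functor E B) (c : Cleavage p)
  (B_lim : has_finite_limits B) (p_ls : locally_small c)
  (I J : B) (U V : Fibre p I) (m : Hom U V) (X Y : Fibre p J) (f : Hom X Y) :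
  (exists (H : B) (F : LiftFamily c m f H), universal_family F) /\
  (forall (H : B) (F : LiftFamily c m f H), universal_family F ->
     ((forall (K : B) (G : LiftFamily c m f K), has_solution G) <-> has_solution F) /\
     (has_solution F <-> exists sol, coherent_choice (c := c) (m := m) (f := f) sol)).
Proof.
split; [apply universal_family_exists; assumption |].
intros H F HF; split; split.
- intros Hall; apply Hall.
- intros HS K G.
  destruct (universal_solution_coherent HF HS) as [sol [Hsol _]].
  exists (sol K G); apply Hsol.
- apply universal_solution_coherent, HF.
- intros [sol [Hsol _]]; exists (sol H F); apply Hsol.
Qed.
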